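(* Let $m\ge3$. Suppose $\theta_1$ is convex, $\theta_i$ is strongly convex with modulus $\mu_i>0$ for $i=2,\dots,m$, and that one of the following conditions holds: 1) for some $i\in\{2,\dots,m\}$, $\nabla\theta_i$ is Lipschitz continuous with constant $L_i$, $A_i$ has full row rank and $\mathcal X_i=\mathbb R^{n_i}$; 2) $\nabla\theta_1$ is Lipschitz continuous with constant $L_1$, $A_1$ is nonsingular and $\mathcal X_1=\mathbb R^{n_1}$. Let $\{(x_1^{k+1},\dots,x_m^{k+1},z^{k+1})\}$ be the sequence generated by the e-ADMM with $$\beta\in\left(0,\ \min_{3\le i\le m}\frac{\mu_i}{\max\{4m-10,\,3m-6.5\}\,\|A_i^\top A_i\|}\right).$$ Then the sequence $\{(A_1x_1^{k+1},A_2x_2^{k+1},\dots,A_mx_m^{k+1},z^{k+1})\}$ converges linearly (R-linearly) to a point in $\{(A_1x_1^*,A_2x_2^*,\dots,A_mx_m^*,z^* ): w^*=(x_1^*,\dots,x_m^*,z^* )\in\mathcal W^*\}$.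
   Context: Problem (P): minimize $\sum_{i=1}^m\theta_i(x_i)$ subject to $\sum_{i=1}^m A_ix_i=b$, $x_i\in\mathcal X_i$ ($i=1,\dots,m$), where $\theta_i:\mathbb R^{n_i}\to\mathbb R$ are closed proper convex functions, $A_i\in\mathbb R^{l\times n_i}$, $\mathcal X_i\subseteq\mathbb R^{n_i}$ are nonempty closed convex sets, and $b\in\mathbb R^l$. The solution set of (P) is assumed nonempty. A function $f$ is strongly convex with modulus $\mu>0$ if $f(tx+(1-t)y)\le tf(x)+(1-t)f(y)-\frac{\mu}{2}t(1-t)\|x-y\|^2$ for all $x,y$ and $t\in[0,1]$. For a matrix, $\|\cdot\|$ is the spectral (2-)norm. Augmented Lagrangian ($\beta>0$): $\mathcal L_\beta(x_1,\dots,x_m,z)=\sum_i\theta_i(x_i)-z^\top(\sum_iA_ix_i-b)+\frac{\beta}{2}\|\sum_iA_ix_i-b\|^2$, $z\in\mathbb R^l$. e-ADMM: from an arbitrary initial $(x_2^0,\dots,x_m^0,z^0)$, for $k=0,1,2,\dots$ compute successively for $i=1,\dots,m$ a minimizer $x_i^{k+1}\in\arg\min\{\mathcal L_\beta(x_1^{k+1},\dots,x_{i-1}^{k+1},x_i,x_{i+1}^k,\dots,x_m^k,z^k): x_i\in\mathcal X_i\}$, and then $z^{k+1}=z^k-\beta(\sum_{i=1}^mA_ix_i^{k+1}-b)$. $\mathcal W=\mathcal X_1\times\cdots\times\mathcal X_m\times\mathbb R^l$, and $\mathcal W^*$ is the set of saddle points in $\mathcal W$ of the Lagrangian $\mathcal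 L(x_1,\dots,x_m,z)=\sum_i\theta_i(x_i)-z^\top(\sum_iA_ix_i-b)$ (minimized over $x_i\in\mathcal X_i$, maximized over $z\in\mathbb R^l$). Standing assumption: $\mathcal W^*\ne\emptyset$. A sequence $y^k$ converges R-linearly to $y$ if there are $c>0$ and $q\in(0,1)$ with $\|y^k-y\|\le c\,q^k$ for all $k$. *)

(* Defs.v *)
From HB Require Import structures.
From mathcomp Require Import all_boot all_order all_algebra.
From mathcomp Require Import all_classical all_reals all_analysis.

Set Implicit Arguments.
Unset Strict Implicit.
Unset Printing Implicit Defensive.

Import Order.TTheory GRing.Theory Num.Theory.
Import numFieldNormedType.Exports.

Local Open Scope classical_set_scope.
Local Open Scope ring_scope.

Definition dotv (R : realType) (n : nat) (u v : 'cV[R]_n) : R :=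
  \sum_(j < n) u j 0 * v j 0.

(* The library norm on matrices is the sup norm, hence the following. *)
Definition enorm (R : realType) (n : nat) (u : 'cV[R]_n) : R :=
  Num.sqrt (dotv u u).

(* The operator norm induced by [enorm]; the unit ball rather than the unit
   sphere is used so that the set is nonempty also when q = 0. *)
Definition spectral_norm (R : realType) (p q : nat) (M : 'M[R]_(p, q)) : R :=
  sup [set enorm (M *m u) | u in [set u : 'cV[R]_q | enorm u <= 1]].

(* Properness is automatic for the real-valued functions considered here. *)
Definition closed_function (R : realType) (n : nat) (f : 'cV[R]_n -> R) : Prop :=
  closed [set p : 'cV[R]_n * R^o | f p.1 <= p.2].

Definition strongly_convex (R : realType) (n : nat) (mu : R)
    (f : 'cV[R]_n -> R) : Prop :=
  forall (u v : 'cV[R]_n) (t : R), 0 <= t <= 1 ->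
    f (t *: u + (1 - t) *: v) <=
      t * f u + (1 - t) * f v - mu / 2 * t * (1 - t) * enorm (u - v) ^+ 2.

Definition grad (R : realType) (n : nat) (f : 'cV[R]_n -> R) (u : 'cV[R]_n) :
    'cV[R]_n :=
  \col_(j < n) 'D_(delta_mx j 0) (f : 'cV[R]_n -> R^o) u.

Definition lipschitz_gradient (R : realType) (n : nat) (L : R)
    (f : 'cV[R]_n -> R) : Prop :=
  (forall u, differentiable (f : 'cV[R]_n -> R^o) u) /\
  (forall u v, enorm (grad f u - grad f v) <= L * enorm (u - v)).

(* The type of M need not be syntactically that of a square matrix. *)
Definition nonsingular (R : realType) (p q : nat) (M : 'M[R]_(p, q)) : Prop :=
  exists e : q = p, castmx (erefl p, e) M \in unitmx.

Definition argmin (R : realType) (T : Type) (D : set T) (f : T -> R) : set T :=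
  [set u | D u /\ forall v, D v -> f u <= f v].

(* (x_1, ..., x_m) with x_i in R^{n_i}. The one-based index i in {1, ..., m} is
   the successor of the value of an element of 'I_m. *)
Definition blocks (R : realType) (m : nat) (n : 'I_m -> nat) : Type :=
  forall i : 'I_m, 'cV[R]_(n i).

Definition objective (R : realType) (m : nat) (n : 'I_m -> nat)
    (theta : forall i : 'I_m, 'cV[R]_(n i) -> R) (x : blocks R n) : R :=
  \sum_(i < m) theta i (x i).

Definition residual (R : realType) (m l : nat) (n : 'I_m -> nat)
    (A : forall i : 'I_m, 'M[R]_(l, n i)) (b : 'cV[R]_l) (x : blocks R n) :
    'cV[R]_l :=
  \sum_(i < m) A i *m x i - b.

Definition block_set (R : realType) (m : nat) (n : 'I_m -> nat)
    (X : forall i : 'I_m, set 'cV[R]_(n i)) : set (blocks R n) :=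
  [set x | forall i, X i (x i)].

Definition solutions (R : realType) (m l : nat) (n : 'I_m -> nat)
    (theta : forall i : 'I_m, 'cV[R]_(n i) -> R)
    (A : forall i : 'I_m, 'M[R]_(l, n i)) (b : 'cV[R]_l)
    (X : forall i : 'I_m, set 'cV[R]_(n i)) : set (blocks R n) :=
  argmin [set x | \sum_(i < m) A i *m x i = b /\ block_set X x]
         (objective theta).

Definition lagrangian (R : realType) (m l : nat) (n : 'I_m -> nat)
    (theta : forall i : 'I_m, 'cV[R]_(n i) -> R)
    (A : forall i : 'I_m, 'M[R]_(l, n i)) (b : 'cV[R]_l)
    (x : blocks R n) (z : 'cV[R]_l) : R :=
  objective theta x - dotv z (residual A b x).

Definition saddle_points (R : realType) (m l : nat) (n : 'I_m -> nat)
    (theta : forall i : 'I_m, 'cV[R]_(n i) -> R)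
    (A : forall i : 'I_m, 'M[R]_(l, n i)) (b : 'cV[R]_l)
    (X : forall i : 'I_m, set 'cV[R]_(n i)) : set (blocks R n * 'cV[R]_l) :=
  [set w | block_set X w.1 /\
    forall (x : blocks R n) (z : 'cV[R]_l), block_set X x ->
      lagrangian theta A b w.1 z <= lagrangian theta A b w.1 w.2
        <= lagrangian theta A b x w.2].

Definition aug_lagrangian (R : realType) (m l : nat) (n : 'I_m -> nat)
    (theta : forall i : 'I_m, 'cV[R]_(n i) -> R)
    (A : forall i : 'I_m, 'M[R]_(l, n i)) (b : 'cV[R]_l) (beta : R)
    (x : blocks R n) (z : 'cV[R]_l) : R :=
  lagrangian theta A b x z + beta / 2 * enorm (residual A b x) ^+ 2.

(* (new_1, ..., new_{i-1}, y, old_{i+1}, ..., old_m) *)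
Definition sweep (R : realType) (m : nat) (n : 'I_m -> nat)
    (new old : blocks R n) (i : 'I_m) (y : 'cV[R]_(n i)) : blocks R n :=
  @dfwith _ (fun j => 'cV[R]_(n j))
    (fun j : 'I_m => if (j < i)%N then new j else old j) i y.

(* The component x_1^0 of [x 0] is never used, so that the initial data is
   (x_2^0, ..., x_m^0, z^0), which is unconstrained. *)
Definition eADMM (R : realType) (m l : nat) (n : 'I_m -> nat)
    (theta : forall i : 'I_m, 'cV[R]_(n i) -> R)
    (A : forall i : 'I_m, 'M[R]_(l, n i)) (b : 'cV[R]_l)
    (X : forall i : 'I_m, set 'cV[R]_(n i)) (beta : R)
    (x : nat -> blocks R n) (z : nat -> 'cV[R]_l) : Prop :=
  forall k : nat,
    (forall i : 'I_m,
      argmin (X i)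
        (fun y => aug_lagrangian theta A b beta (sweep (x k.+1) (x k) y) (z k))
        (x k.+1 i)) /\
    z k.+1 = z k - beta *: residual A b (x k.+1).

(* (A_1 x_1, ..., A_m x_m, z), stacked into one column *)
Definition image_point (R : realType) (m l : nat) (n : 'I_m -> nat)
    (A : forall i : 'I_m, 'M[R]_(l, n i)) (x : blocks R n) (z : 'cV[R]_l) :
    'cV[R]_(\sum_(i < m) l + l) :=
  col_mx (\mxcol_(i < m) (A i *m x i)) z.

Definition R_linear_cvg (R : realType) (N : nat) (y : nat -> 'cV[R]_N)
    (ylim : 'cV[R]_N) : Prop :=
  exists c q : R, [/\ 0 < c, 0 < q < 1 &
    forall k : nat, enorm (y k - ylim) <= c * q ^+ k].

(* Division is in the extended reals, where mu / 0 = +oo for mu > 0: a block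
   with A_i = 0 imposes no restriction on beta. *)
Definition beta_bound (R : realType) (m l : nat) (n : 'I_m -> nat)
    (A : forall i : 'I_m, 'M[R]_(l, n i)) (mu : 'I_m -> R) : \bar R :=
  (\big[mine/+oo]_(i < m | (3 <= i.+1)%N)
    ((mu i)%:E /
     (Num.max (4 * m%:R - 10) (3 * m%:R - 13 / 2)
        * spectral_norm ((A i)^T *m A i))%:E))%E.

(* Main.v *)
Require Import Defs.
From mathcomp Require Import all_boot all_order all_algebra.
From mathcomp Require Import all_classical all_reals all_analysis.
From mathcomp Require Import ring lra.

(** The proof exhibits a Lyapunov function that decreases geometrically.
    Blocks are indexed from 0. Fix a saddle point [(xs, zs)], and let
    [a_i^k = A_i (x_i^k - xs_i)], [p^k = (z^k - zs) / beta] and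
    [d_i^k = a_i^{k+1} - a_i^k]; the update of the multiplier reads
    [p^k - p^{k+1} = \sum_i a_i^{k+1}].

    The minimizer [x_i^{k+1}] of a block subproblem is stationary for the
    multiplier [z^{k+1} + beta \sum_{j > i} d_j^k], and [xs_i] is stationary
    for [zs] ([eADMM_block_stationary], [saddle_block_stationary]).
    Monotonicity of the subdifferential is used twice: between iterate [k+2] and
    the saddle point, which is the usual energy estimate, and between the
    iterates [k+1] and [k+2]. The second use is what makes the estimate close:
    it turns the products [<p^{k+1} - p^{k+2}, d_i^{k+1}>] into products of
    increments of two blocks. Summing both ([energy_balance]), the only terms
    without a sign are products [<d_i, w_j>] with [1 <= i < j], so the second
    factor always belongs to one of the blocks [2, ..., m - 1], whose strong
    convexity dominates [beta |A_i^T A_i|] by the choice of [beta]. Young's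
    inequality lets it absorb them ([merit_decrease]): the function [merit]
    decreases at each step by at least a constant times the value at the new
    iterate of
    [B^k = |p^k - p^{k+1}|^2
       + \sum_{i >= 1} (|x_i^{k+1} - xs_i|^2 + |d_i^k|^2)].

    Conversely [B] bounds [merit] up to a constant. The only part of [merit] for
    which this is not immediate is [p^{k+1}]. If block [i] is smooth and
    unconstrained, stationarity is the equation
    [grad theta_i (x_i) = A_i^T zeta], where [zeta] is the multiplier of that
    block, and [A_i^T] is injective; hence the error of the multiplier is at
    most a constant times [|x_i - xs_i|] ([multiplier_error_bound]). For
    [i >= 1] this is in [B]; for [i = 0], [A_0] is injective and [a_0] is
    [p^k - p^{k+1}] minus the other [a_j], all of which [B] controls. A decrease
    proportional to the function itself gives the rate, and [B] also bounds the
    squared distance to the limit, the image of [(xs, zs)]. *)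

Import Order.TTheory GRing.Theory Num.Theory.
Import numFieldNormedType.Exports.

Local Open Scope classical_set_scope.
Local Open Scope ring_scope.

Set Implicit Arguments.
Unset Strict Implicit.
Unset Printing Implicit Defensive.

(** * The Euclidean inner product *)

Section DotProduct.
Variables (R : realType) (N : nat).
Implicit Types (u v w : 'cV[R]_N) (a : R).

Lemma dotvC u v : dotv u v = dotv v u.
Proof. by apply: eq_bigr => j _; rewrite mulrC. Qed.

Lemma dotvDl u v w : dotv (u + v) w = dotv u w + dotv v w.
Proof. by rewrite -big_split; apply: eq_bigr => j _; rewrite mxE mulrDl. Qed.

Lemma dotv_trmx u v : dotv u v = (u^T *m v) 0 0.
Proof. by rewrite mxE; apply: eq_bigr => j _; rewrite mxE. Qed.

Lemma dotvZl a u v : dotv (a *: u) v = a * dotv u v.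
Proof. by rewrite mulr_sumr; apply: eq_bigr => j _; rewrite mxE mulrA. Qed.

Lemma dotvNl u v : dotv (- u) v = - dotv u v.
Proof. by rewrite -scaleN1r dotvZl mulN1r. Qed.

Lemma dotvBl u v w : dotv (u - v) w = dotv u w - dotv v w.
Proof. by rewrite dotvDl dotvNl. Qed.

Lemma dotvDr u v w : dotv w (u + v) = dotv w u + dotv w v.
Proof. by rewrite dotvC dotvDl !(dotvC w). Qed.

Lemma dotvZr a u v : dotv u (a *: v) = a * dotv u v.
Proof. by rewrite dotvC dotvZl dotvC. Qed.

Lemma dotvNr u v : dotv u (- v) = - dotv u v.
Proof. by rewrite dotvC dotvNl dotvC. Qed.

Lemma dotvBr u v w : dotv w (u - v) = dotv w u - dotv w v.
Proof. by rewrite dotvDr dotvNr. Qed.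

Lemma dot0v u : dotv 0 u = 0.
Proof. by rewrite -(scale0r 0) dotvZl mul0r. Qed.

Lemma dotv_suml (I : finType) (P : pred I) (F : I -> 'cV[R]_N) v :
  dotv (\sum_(i | P i) F i) v = \sum_(i | P i) dotv (F i) v.
Proof.
elim/big_ind2: _ => [|x1 x2 y1 y2 <- <-|//]; first exact: dot0v.
by rewrite dotvDl.
Qed.

Lemma dotv_sumr (I : finType) (P : pred I) (F : I -> 'cV[R]_N) v :
  dotv v (\sum_(i | P i) F i) = \sum_(i | P i) dotv v (F i).
Proof. by rewrite dotvC dotv_suml; apply: eq_bigr => i _; rewrite dotvC. Qed.

Lemma dotvv_ge0 u : 0 <= dotv u u.
Proof. by apply: sumr_ge0 => j _; rewrite -expr2 sqr_ge0. Qed.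

Lemma dotvv_eq0 u : dotv u u = 0 -> u = 0.
Proof.
move=> u0; apply/matrixP => i j; rewrite (ord1 j) mxE; apply/eqP.
have : dotv u u == 0 by rewrite u0.
rewrite psumr_eq0 => [|k _]; last by rewrite -expr2 sqr_ge0.
by move=> /allP/(_ i (mem_index_enum i)) /=; rewrite mulf_eq0 orbb.
Qed.

Lemma enorm_ge0 u : 0 <= enorm u. Proof. exact: sqrtr_ge0. Qed.

Lemma enorm_sqr u : enorm u ^+ 2 = dotv u u.
Proof. by rewrite sqr_sqrtr ?dotvv_ge0. Qed.

Lemma enormZ a u : enorm (a *: u) = `|a| * enorm u.
Proof.
by rewrite /enorm dotvZl dotvZr mulrA -expr2 sqrtrM ?sqr_ge0 // sqrtr_sqr.
Qed.

Lemma dotvv_distC u v : dotv (u - v) (u - v) = dotv (v - u) (v - u).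
Proof. by rewrite -opprB dotvNl dotvNr opprK. Qed.

Lemma dotv_polarization u v :
  2 * dotv u (u - v) = dotv u u + dotv (u - v) (u - v) - dotv v v.
Proof. by rewrite !(dotvBl, dotvBr) (dotvC v u); ring. Qed.

(** Young's inequality with weight [k]. *)
Lemma dotv_young k u v : 0 < k ->
  - dotv u v <= (2 * k)^-1 * dotv u u + k / 2 * dotv v v.
Proof.
move=> k_gt0; rewrite -subr_ge0.
have -> : (2 * k)^-1 * dotv u u + k / 2 * dotv v v - - dotv u v =
    (2 * k)^-1 * dotv (u + k *: v) (u + k *: v).
  rewrite !(dotvDl, dotvDr, dotvZl, dotvZr) (dotvC v u); field.
  by rewrite gt_eqF.
by rewrite mulr_ge0 ?dotvv_ge0 // invr_ge0 mulr_ge0 // ltW.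
Qed.

Lemma dotvvD_le u v : dotv (u + v) (u + v) <= 2 * dotv u u + 2 * dotv v v.
Proof.
have := dotv_young (- u) v ltr01; rewrite dotvNl dotvNl dotvNr.
by rewrite !(dotvDl, dotvDr) (dotvC v u); lra.
Qed.

Lemma dotvvB_le u v : dotv (u - v) (u - v) <= 2 * dotv u u + 2 * dotv v v.
Proof. by have := dotvvD_le u (- v); rewrite dotvNl dotvNr opprK. Qed.

Lemma dotvv_sum_le (I : finType) (P : pred I) (F : I -> 'cV[R]_N) :
  dotv (\sum_(i | P i) F i) (\sum_(i | P i) F i) <=
    #|P|%:R * \sum_(i | P i) dotv (F i) (F i).
Proof.
set S := \sum_(i | P i) dotv (F i) (F i).
have -> : #|P|%:R * S = \sum_(i | P i) \sum_(j | P j)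
    (dotv (F i) (F i) / 2 + dotv (F j) (F j) / 2).
  under eq_bigr => i _ do rewrite big_split /= sumr_const -mulr_suml -/S.
  rewrite big_split /= sumr_const sumrMnl -mulr_suml -/S -!(mulr_natl (S / 2)).
  by rewrite -mulrDr -splitr.
rewrite dotv_suml; apply: ler_sum => i _.
rewrite dotv_sumr; apply: ler_sum => j _.
by have := dotvv_ge0 (F i - F j); rewrite !(dotvBl, dotvBr) (dotvC (F j)); lra.
Qed.

Lemma dotv_cauchy_schwarz u v : dotv u v <= enorm u * enorm v.
Proof.
have [u0|u_neq0] := eqVneq (enorm u) 0.
  have -> : u = 0 by apply: dotvv_eq0; rewrite -enorm_sqr u0 expr0n.
  by rewrite dot0v mulr_ge0 ?enorm_ge0.
have [v0|v_neq0] := eqVneq (enorm v) 0.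
  have -> : v = 0 by apply: dotvv_eq0; rewrite -enorm_sqr v0 expr0n.
  by rewrite dotvC dot0v mulr_ge0 ?enorm_ge0.
have u_gt0 : 0 < enorm u by rewrite lt_def u_neq0 enorm_ge0.
have v_gt0 : 0 < enorm v by rewrite lt_def v_neq0 enorm_ge0.
have := dotvv_ge0 (enorm v *: u - enorm u *: v).
rewrite !(dotvBl, dotvBr, dotvZl, dotvZr) -!enorm_sqr (dotvC v u) => uv.
rewrite -(ler_pM2l (mulr_gt0 u_gt0 v_gt0)) -subr_ge0.
apply: le_trans (mulr_ge0 (_ : 0 <= 2^-1) uv) _; first by rewrite invr_ge0.
by lra.
Qed.

End DotProduct.

Lemma dotv_mulmx_tr (R : realType) (p q : nat) (M : 'M[R]_(p, q)) u v :
  dotv (M *m u) v = dotv u (M^T *m v).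
Proof.
by rewrite !dotv_trmx trmx_mul mulmxA.
Qed.

Lemma dotv_col_mx (R : realType) (p q : nat) (u : 'cV[R]_p) (v : 'cV[R]_q) :
  dotv (col_mx u v) (col_mx u v) = dotv u u + dotv v v.
Proof.
rewrite /dotv big_split_ord /=; congr (_ + _); apply: eq_bigr => j _.
  by rewrite col_mxEu.
by rewrite col_mxEd.
Qed.

Lemma dotv_mxcol (R : realType) (m : nat) (p : 'I_m -> nat)
    (u : forall i, 'cV[R]_(p i)) :
  dotv (\mxcol_i u i) (\mxcol_i u i) = \sum_(i < m) dotv (u i) (u i).
Proof.
rewrite dotv_trmx tr_mxcol mul_mxrow_mxcol summxE.
by apply: eq_bigr => i _; rewrite -dotv_trmx.
Qed.

(** * Matrix norms *)

(** The squared Frobenius norm serves as the constant. *)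
Lemma dotv_mulmx_bounded (R : realType) (p q : nat) (M : 'M[R]_(p, q)) :
  exists2 c : R, 0 <= c & forall u, dotv (M *m u) (M *m u) <= c * dotv u u.
Proof.
pose r i := (row i M)^T.
exists (\sum_i dotv (r i) (r i)) => [|u].
  by apply: sumr_ge0 => i _; apply: dotvv_ge0.
rewrite {1}/dotv mulr_suml; apply: ler_sum => i _.
have -> : (M *m u) i 0 = dotv (r i) u.
  by rewrite mxE; apply: eq_bigr => j _; rewrite !mxE.
have := dotv_cauchy_schwarz (r i) u; have := dotv_cauchy_schwarz (- r i) u.
rewrite dotvNl /enorm dotvNl dotvNr opprK -/(enorm (r i)) -/(enorm u).
rewrite -!enorm_sqr -exprMn -expr2 => lo hi.
rewrite -[leLHS]real_normK ?num_real // lerXn2r ?nnegrE //.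
  by rewrite mulr_ge0 ?enorm_ge0.
by rewrite ler_norml; lra.
Qed.

Lemma enorm_mulmx_le (R : realType) (p q : nat) (M : 'M[R]_(p, q)) u :
  enorm (M *m u) <= spectral_norm M * enorm u.
Proof.
have [c c_ge0 Mc] := dotv_mulmx_bounded M.
have [u0|u_neq0] := eqVneq (enorm u) 0.
  have -> : u = 0 by apply: dotvv_eq0; rewrite -enorm_sqr u0 expr0n.
  by rewrite mulmx0 /enorm !dot0v sqrtr0 mulr0.
have u_gt0 : 0 < enorm u by rewrite lt_def u_neq0 enorm_ge0.
rewrite -ler_pdivrMr //.
have -> : enorm (M *m u) / enorm u = enorm (M *m ((enorm u)^-1 *: u)).
  by rewrite -scalemxAr enormZ ger0_norm ?invr_ge0 ?enorm_ge0 // mulrC.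
apply: ub_le_sup => /=.
  exists (Num.sqrt c) => _ [w /= w_le1 <-]; apply: ler_wsqrtr.
  apply: (le_trans (Mc w)); rewrite ler_piMr // -enorm_sqr.
  by rewrite expr_le1 ?enorm_ge0.
by exists ((enorm u)^-1 *: u) => //=; rewrite enormZ ger0_norm ?invr_ge0
  ?enorm_ge0 // mulVf.
Qed.

(** [|M u|^2 = <u, M^T M u>], hence the square of the norm of [M] is the norm of
    the Gram matrix. *)
Lemma dotv_mulmx_le_gram (R : realType) (p q : nat) (M : 'M[R]_(p, q)) u :
  dotv (M *m u) (M *m u) <= spectral_norm (M^T *m M) * dotv u u.
Proof.
rewrite dotv_mulmx_tr mulmxA; apply: (le_trans (dotv_cauchy_schwarz _ _)).
rewrite -enorm_sqr expr2 mulrCA; apply: ler_wpM2l; first exact: enorm_ge0.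
exact: enorm_mulmx_le.
Qed.

(** * First-order conditions at a constrained minimizer *)

Lemma ge0_of_affine_near0 (R : realFieldType) (a b : R) :
  (forall t, 0 < t <= 1 -> 0 <= a + t * b) -> 0 <= a.
Proof.
move=> ab_ge0; rewrite leNgt; apply/negP => a_lt0.
have b_ge0 := normr_ge0 b; have b_le := ler_norm b.
have d_gt0 : 0 < - a + `|b| by lra.
(* The denominator is at least [- a], so that [t <= 1], and larger than [|b|],
   so that [a + t * b] is still negative. *)
have := ab_ge0 (- a / (- a + `|b|)).
rewrite divr_gt0 ?oppr_gt0 // ler_pdivrMr // mul1r lerDl b_ge0 => /(_ isT).
rewrite -(pmulr_lge0 _ d_gt0) mulrDl mulrAC divfK ?gt_eqF //.
by apply/negP; rewrite -ltNge; nra.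
Qed.

Lemma strongly_convex0 (R : realType) (n : nat) (f : 'cV[R]_n -> R) :
  convex_function setT f -> strongly_convex 0 f.
Proof.
move=> fconv u v t /andP[t_ge0 t_le1].
have := fconv (Itv01 t_ge0 t_le1) u v; rewrite !in_setT => /(_ isT isT).
by rewrite !mul0r subr0.
Qed.

(** The minimum is compared with the values along the segment from [u] to [y],
    and the difference quotient at [u] is taken to its limit; [g] is the smooth
    part of the objective, [G] its directional derivative. *)
Lemma argmin_first_order (R : realType) (n : nat) (mu : R)
    (f g : 'cV[R]_n -> R) (D : set 'cV[R]_n) (u y : 'cV[R]_n) (G K : R) :
  strongly_convex mu f -> convex_set D ->
  argmin D (fun v => f v + g v) u -> D y ->
  (forall t, g (t *: y + (1 - t) *: u) = g u + t * G + t ^+ 2 * K) ->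
  mu / 2 * dotv (y - u) (y - u) <= f y - f u + G.
Proof.
move=> fconv Dconv [Du u_min] Dy gE; rewrite -subr_ge0.
apply: (@ge0_of_affine_near0 _ _ (mu / 2 * dotv (y - u) (y - u) + K)) => t.
move=> /andP[t_gt0 t_le1].
have Dt : D (t *: y + (1 - t) *: u).
  have := Dconv y u (Itv01 (ltW t_gt0) t_le1); rewrite !inE; exact.
have := u_min _ Dt; rewrite gE.
have := fconv y u t; rewrite (ltW t_gt0) t_le1 enorm_sqr => /(_ isT).
move=> f_le fg_le; rewrite -(pmulr_rge0 _ t_gt0); lra.
Qed.

(** The one-sided difference quotients bound the derivative along [v] from below
    by [<v, w>]; linearity in [v] turns this into an equality. *)
Lemma grad_subgradient (R : realType) (n : nat) (f : 'cV[R]_n -> R) u w :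
  differentiable (f : 'cV[R]_n -> R^o) u ->
  (forall y, dotv (y - u) w <= f y - f u) -> grad f u = w.
Proof.
move=> fdiff f_ge.
have der_ge v : dotv v w <= 'D_v (f : 'cV[R]_n -> R^o) u.
  have /cvg_dnbhs_at_right fv := @diff_derivable _ _ _ _ _ v fdiff.
  rewrite /derive -(cvg_lim _ fv) //.
  apply: limr_ge; first by apply/cvg_ex; eexists; exact: fv.
  near=> h; have h_gt0 : 0 < h by near: h; exact: nbhs_right_gt.
  rewrite ler_pdivlMl // -dotvZl; have := f_ge (h *: v + u).
  by rewrite addrK.
apply/matrixP => i j; rewrite (ord1 j) mxE.
have -> : w i 0 = dotv (delta_mx i 0) w.
  rewrite /dotv (bigD1 i) //= big1 => [|k ki]; rewrite mxE.
    by rewrite !eqxx mul1r addr0.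
  by rewrite (negbTE ki) mul0r.
apply/le_anti; rewrite der_ge andbT.
have := der_ge (- delta_mx i 0); rewrite dotvNl !deriveE // linearN.
by rewrite lerN2.
Unshelve. all: by end_near. Qed.

(** * The descent inequality *)

(** Here [v], [u], [u'] are the images of the errors at three successive
    iterates, the latest first; [p] and [p0] are the scaled dual errors that
    belong to [v] and [u]. The numbers [M] and [N] are what strong convexity
    adds to monotonicity, between the latest iterate and the solution, and
    between the two latest iterates. *)
Section Descent.
Variables (R : realType) (l m : nat).
Variables (p p0 : 'cV[R]_l) (v u u' : 'I_m -> 'cV[R]_l) (M N : 'I_m -> R).
Let d i := v i - u i.
Let d' i := u i - u' i.

(** Adding the hypotheses on [N] to those on [M] cancels every product of [d i]
    with [p0 - p]: exchanging the double sum over [i < j] leaves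
    [<\sum_(i < j) v_i, d_j>], and the inner sum is [p0 - p] minus the [v_i]
    with [j <= i]. *)
Lemma energy_balance :
  p0 - p = \sum_i v i ->
  (forall i, M i <= dotv (v i) (p + \sum_(j < m | (i < j)%N) d j)) ->
  (forall i : 'I_m, (0 < i)%N ->
     N i <= dotv (d i) (\sum_(j < m | (i < j)%N) (d j - d' j) - (p0 - p))) ->
  2^-1 * dotv p p + 2^-1 * \sum_(i < m | (0 < i)%N) dotv (v i) (v i)
    + 2^-1 * dotv (p0 - p) (p0 - p)
    + 2^-1 * \sum_(i < m | (0 < i)%N) dotv (d i) (d i)
    + \sum_i M i + \sum_(i < m | (0 < i)%N) N i
  <= 2^-1 * dotv p0 p0 + 2^-1 * \sum_(i < m | (0 < i)%N) dotv (u i) (u i)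
     - \sum_(i < m | (0 < i)%N) \sum_(j < m | (i < j)%N)
         dotv (d i) (u j + d' j).
Proof.
set s := p0 - p => sE hM hN.
have {hM} sumM : \sum_i M i <= dotv s p + \sum_(j < m | (0 < j)%N)
    (dotv s (d j) - dotv (v j) (d j)
     - \sum_(i < m | (j < i)%N) dotv (v i) (d j)).
  have -> : \sum_(j < m | (0 < j)%N) (dotv s (d j) - dotv (v j) (d j)
      - \sum_(i < m | (j < i)%N) dotv (v i) (d j)) =
      \sum_(i < m) \sum_(j < m | (i < j)%N) dotv (v i) (d j).
    rewrite (exchange_big_dep (fun j : 'I_m => (0 < j)%N)) /=; last first.
      by move=> i j _; apply: leq_ltn_trans.
    apply: eq_bigr => j _.
    have {}sE : s = \sum_(i < m | (i < j)%N) v i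
        + (v j + \sum_(i < m | (j < i)%N) v i).
      rewrite sE (bigID (fun i : 'I_m => (i < j)%N)) /=; congr (_ + _).
      rewrite (bigD1 j) ?ltnn //=; congr (_ + _); apply: eq_bigl => i.
      by rewrite -leqNgt ltn_neqAle eq_sym andbC.
    rewrite -!dotv_suml -!dotvBl; congr (dotv _ _).
    by rewrite -addrA -opprD sE addrK.
  rewrite sE dotv_suml -big_split; apply: ler_sum => i _.
  by rewrite /= -dotv_sumr -dotvDr; apply: hM.
have {hN} sumN : \sum_(i < m | (0 < i)%N) N i <= \sum_(i < m | (0 < i)%N)
    (\sum_(j < m | (i < j)%N) dotv (d i) (d j - d' j) - dotv (d i) s).
  by apply: ler_sum => i i_gt0; rewrite -dotv_sumr -dotvBr; apply: hN.
have pE : 2 * dotv s p = dotv p0 p0 - dotv p p - dotv s s.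
  by rewrite /s !(dotvBl, dotvBr) (dotvC p0 p); ring.
have {sumM} := lerD sumM sumN; rewrite -addrA -big_split /=.
rewrite [X in _ <= dotv s p + X -> _](eq_bigr (fun i =>
   2^-1 * dotv (u i) (u i) - 2^-1 * dotv (v i) (v i)
   - 2^-1 * dotv (d i) (d i)
   - \sum_(j < m | (i < j)%N) dotv (d i) (u j + d' j))); last first.
  move=> i _. rewrite (dotvC s).
  have := dotv_polarization (v i) (u i); rewrite -/(d i) => vd.
  have -> : \sum_(j < m | (i < j)%N) dotv (d i) (u j + d' j) =
      \sum_(j < m | (i < j)%N) dotv (v j) (d i) -
      \sum_(j < m | (i < j)%N) dotv (d i) (d j - d' j).
    rewrite -sumrB; apply: eq_bigr => j _.
    rewrite (dotvC (v j)) -dotvBr; congr (dotv _ _).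
    by rewrite /d; move: (d' j) => t; rewrite opprB addrCA subKr addrC.
  by lra.
by rewrite !sumrB -!mulr_sumr; lra.
Qed.

End Descent.

(** Each product is split with a weight depending on the first index only. Block
    1 takes the weight [m - 2], the number of its products, because only half of
    its squared increment is available to absorb them; the other blocks take
    weight 1, which keeps the constants linear in [m]. *)
Lemma cross_terms_le (R : realType) (l m : nat) (d w : 'I_m -> 'cV[R]_l)
    (i1 : 'I_m) : (3 <= m)%N -> i1 = 1%N :> nat ->
  - \sum_(i < m | (0 < i)%N) \sum_(j < m | (i < j)%N) dotv (d i) (w j) <=
    2^-1 * dotv (d i1) (d i1)
    + (m%:R - 2) / 2 * \sum_(i < m | (1 < i)%N) dotv (d i) (d i)
    + (m%:R - 2) * \sum_(j < m | (1 < j)%N) dotv (w j) (w j).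
Proof.
move=> m_ge3 i1E.
have sumC (c : R) : \sum_(j < m | (1 < j)%N) c = (m%:R - 2) * c.
  case: m m_ge3 {d w i1 i1E} => [|[|m]] // _.
  rewrite big_mkcond big_ord_recl big_ord_recl /= !add0r sumr_const card_ord.
  by rewrite -(mulr_natl c) -(addn2 m) natrD addrK.
have m_gt2 : 2 < m%:R :> R by rewrite ltr_nat.
have split1 (F : 'I_m -> R) :
    \sum_(i < m | (0 < i)%N) F i = F i1 + \sum_(i < m | (1 < i)%N) F i.
  rewrite (bigD1 i1) ?i1E //=; congr (_ + _); apply: eq_bigl => i.
  by rewrite -(inj_eq val_inj) /= i1E [RHS]ltn_neqAle eq_sym andbC.
pose k (i : 'I_m) : R := if i == i1 then m%:R - 2 else 1.
have k_gt0 i : 0 < k i by rewrite /k; case: ifP => // _; lra.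
pose W := \sum_(j < m | (1 < j)%N) dotv (w j) (w j).
have row_le (i : 'I_m) : (0 < i)%N ->
    - \sum_(j < m | (i < j)%N) dotv (d i) (w j) <=
    (2 * k i)^-1 * (m%:R - 2) * dotv (d i) (d i) + k i / 2 * W.
  move=> i_gt0.
  apply: (@le_trans _ _ (\sum_(j < m | (1 < j)%N)
      ((2 * k i)^-1 * dotv (d i) (d i) + k i / 2 * dotv (w j) (w j)))).
    rewrite -sumrN [leLHS]big_mkcond [leRHS]big_mkcond /=.
    apply: ler_sum => j _; case: ifP => [ij|_].
      by rewrite (leq_ltn_trans i_gt0 ij); apply: dotv_young.
    case: ifP => // _; rewrite addr_ge0 // mulr_ge0 ?dotvv_ge0 //.
      by rewrite invr_ge0 mulr_ge0 // ltW.
    by rewrite divr_ge0 // ltW.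
  rewrite big_split /= -mulr_sumr -/W sumC.
  by rewrite -mulr_sumr -/W mulrA.
rewrite -sumrN; apply: (le_trans (ler_sum _ row_le)).
rewrite split1 /k eqxx.
rewrite (eq_bigr (fun i => (m%:R - 2) / 2 * dotv (d i) (d i) + W / 2)).
  rewrite big_split /= -mulr_sumr sumC.
  have -> : (2 * (m%:R - 2 : R))^-1 * (m%:R - 2) = 2^-1.
    by rewrite invfM mulfVK // subr_eq0 gt_eqF.
  by rewrite -/W; lra.
move=> i i_gt1; rewrite ifN; last by apply: contraTneq i_gt1 => ->; rewrite i1E.
by rewrite mulr1; ring.
Qed.

(** The Lyapunov function of the method: [p] is the dual error divided by
    [beta], [a i] is the image under [A_i] of the error of block [i], and [d i]
    is the last increment of [a i]. The last sum pays, at the next step, for the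
    products that involve the two preceding iterates. *)
Definition merit (R : realType) (l m : nat) (p : 'cV[R]_l)
    (a d : 'I_m -> 'cV[R]_l) : R :=
  2^-1 * dotv p p + 2^-1 * \sum_(i < m | (0 < i)%N) dotv (a i) (a i)
  + 2 * (m%:R - 2)
    * \sum_(i < m | (1 < i)%N) (dotv (a i) (a i) + dotv (d i) (d i)).

(** The cross terms of [energy_balance] are paid for by strong convexity. By
    [cross_terms_le] and [|u + d'|^2 <= 2 |u|^2 + 2 |d'|^2], a block [i > 1]
    needs the coefficient [2 m - 4] on [|v_i|^2] from [M], and on [|d_i|^2] from
    [N] the coefficient [5 m / 2 - 11 / 2 + eps] beyond the [1 / 2] of
    [energy_balance]. As [m >= 3] and [eps <= 1 / 2], [3 m - 13 / 2] is at least
    both. Block 1 only spends the half of its squared increment, so an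
    arbitrarily small modulus is enough for it. *)
Lemma merit_decrease (R : realType) (l m : nat) (p p0 : 'cV[R]_l)
    (v u u' : 'I_m -> 'cV[R]_l) (M N E : 'I_m -> R) (eps : R) :
  (3 <= m)%N -> eps <= 2^-1 ->
  p0 - p = \sum_i v i ->
  (forall i, M i <= dotv (v i) (p + \sum_(j < m | (i < j)%N) (v j - u j))) ->
  (forall i : 'I_m, (0 < i)%N ->
     N i <= dotv (v i - u i)
       (\sum_(j < m | (i < j)%N) ((v j - u j) - (u j - u' j)) - (p0 - p))) ->
  (forall i : 'I_m, 0 <= M i) ->
  (forall i : 'I_m, i = 1%N :> nat ->
     eps * E i <= M i /\ eps * dotv (v i - u i) (v i - u i) <= N i) ->
  (forall i : 'I_m, (1 < i)%N ->
     (3 * m%:R - 13 / 2) * dotv (v i) (v i) + eps * E i <= M i /\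
     (3 * m%:R - 13 / 2) * dotv (v i - u i) (v i - u i) <= N i) ->
  merit p v (fun i => v i - u i)
    + (2^-1 * dotv (p0 - p) (p0 - p)
       + eps * \sum_(i < m | (0 < i)%N)
           (E i + dotv (v i - u i) (v i - u i)))
  <= merit p0 u (fun i => u i - u' i).
Proof.
move=> m_ge3 eps_le sE hM hN M_ge0 MN1 MN.
have m_ge3R : 3 <= m%:R :> R by rewrite ler_nat.
have := energy_balance sE hM hN.
have i1P : (1 < m)%N by apply: leq_trans m_ge3.
pose i1 := Ordinal i1P.
have := cross_terms_le (fun i => v i - u i) (fun i => u i + (u i - u' i))
  m_ge3 (erefl : i1 = 1%N :> nat).
have split1 (F : 'I_m -> R) :
    \sum_(i < m | (0 < i)%N) F i = F i1 + \sum_(i < m | (1 < i)%N) F i.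
  rewrite (bigD1 i1) //=; congr (_ + _); apply: eq_bigl => i.
  by rewrite -(inj_eq val_inj) /= [RHS]ltn_neqAle eq_sym andbC.
have MR : \sum_(i < m | (0 < i)%N) M i <= \sum_i M i.
  by rewrite [leLHS]big_mkcond; apply: ler_sum => i _; case: ifP.
have [M1 N1] := MN1 i1 erefl.
pose S F := \sum_(i < m | (1 < i)%N) (F i : R).
have MS :
    (3 * m%:R - 13 / 2) * S (fun i => dotv (v i) (v i)) + eps * S E <= S M.
  by rewrite /S !mulr_sumr -big_split; apply: ler_sum => i /MN[].
have NS :
    (3 * m%:R - 13 / 2) * S (fun i => dotv (v i - u i) (v i - u i)) <= S N.
  by rewrite /S mulr_sumr; apply: ler_sum => i /MN[].
have WS : S (fun i => dotv (u i + (u i - u' i)) (u i + (u i - u' i))) <=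
    2 * S (fun i => dotv (u i) (u i))
    + 2 * S (fun i => dotv (u i - u' i) (u i - u' i)).
  by rewrite /S !mulr_sumr -big_split; apply: ler_sum => i _; apply: dotvvD_le.
have S_ge0 (F : 'I_m -> 'cV[R]_l) : 0 <= S (fun i => dotv (F i) (F i)).
  by apply: sumr_ge0 => i _; apply: dotvv_ge0.
have V_ge0 := S_ge0 v; have D_ge0 := S_ge0 (fun i => v i - u i).
rewrite /merit !split1 !big_split /= in MR *.
move: MS NS WS V_ge0 D_ge0 MR; rewrite /S.
set sv := \sum_(i < m | _) dotv (v i) (v i).
set sd := \sum_(i < m | _) dotv (v i - u i) (v i - u i).
set su := \sum_(i < m | _) dotv (u i) (u i).
set su' := \sum_(i < m | _) dotv (u i - u' i) (u i - u' i).
set sw := \sum_(i < m | _) dotv (u i + _) _.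
set sM := \sum_(i < m | _) M i; set sN := \sum_(i < m | _) N i.
set sE' := \sum_(i < m | _) E i; set cross := _ (\sum_(j < m | _) _) _.
move=> MS NS WS V_ge0 D_ge0 MR CS EB.
have WS' : (m%:R - 2) * sw <= (m%:R - 2) * (2 * su + 2 * su').
  by apply: ler_wpM2l => //; lra.
have V' : 0 <= (m%:R - 5 / 2) * sv by apply: mulr_ge0 => //; lra.
have D1 : 0 <= (m%:R / 2 - 3 / 2) * sd by apply: mulr_ge0 => //; lra.
have D2 : 0 <= (2^-1 - eps) * sd by apply: mulr_ge0 => //; lra.
lra.
Qed.

(** * Linear rates *)

(** A decrease [D k >= F k.+1 / C] contracts [F] by the factor [C / (C + 1)];
    [C + 1] in place of [C] keeps the ratio positive. *)
Lemma sqrt_geometric_bound (R : realType) (F D Y : nat -> R) (C : R) :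
  0 <= C -> (forall k, 0 <= F k) -> (forall k, 0 <= D k) ->
  (forall k, 0 <= Y k) ->
  (forall k, F k.+1 + D k <= F k) ->
  (forall k, F k.+1 <= C * D k) -> (forall k, Y k.+1 <= C * D k) ->
  exists c q : R, [/\ 0 < c, 0 < q < 1 &
    forall k, Num.sqrt (Y k) <= c * q ^+ k].
Proof.
move=> C_ge0 F_ge0 D_ge0 Y_ge0 F_dec FD YD.
pose r := (C + 1) / (C + 2).
have r_gt0 : 0 < r by rewrite divr_gt0 //; lra.
have r_lt1 : r < 1 by rewrite ltr_pdivrMr; lra.
have F_geo k : F k <= F 0%N * r ^+ k.
  elim: k => [|k IH]; first by rewrite expr0 mulr1.
  rewrite exprS mulrCA; apply: (@le_trans _ _ (r * F k)); last first.
    by rewrite ler_pM2l.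
  rewrite /r mulrAC ler_pdivlMr; last by lra.
  have : 0 <= (C + 1) * (F k - (F k.+1 + D k)).
    by rewrite mulr_ge0 ?subr_ge0 ?F_dec //; lra.
  by have := FD k; have := D_ge0 k; lra.
have D_le k : D k <= F k by have := F_dec k; have := F_ge0 k.+1; lra.
pose c0 := Y 0%N + C * F 0%N / r + 1.
have CFr_ge0 : 0 <= C * F 0%N / r.
  by rewrite divr_ge0 ?(ltW r_gt0) // mulr_ge0.
have c0_ge0 : 0 < c0 by rewrite /c0; have := Y_ge0 0%N; lra.
have Y_geo k : Y k <= c0 * r ^+ k.
  case: k => [|k]; first by rewrite expr0 mulr1 /c0; lra.
  apply: (@le_trans _ _ (C * F 0%N / r * r ^+ k.+1)); last first.
    by rewrite ler_pM2r ?exprn_gt0 // /c0; have := Y_ge0 0%N; lra.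
  rewrite exprS mulrA divfK ?gt_eqF // -mulrA.
  apply: (le_trans (YD k)); apply: ler_wpM2l => //.
  exact: le_trans (D_le k) (F_geo k).
exists (Num.sqrt c0), (Num.sqrt r); split.
- by rewrite sqrtr_gt0.
- by rewrite sqrtr_gt0 r_gt0 -sqrtr1 ltr_sqrt.
move=> k; apply: (le_trans (ler_wsqrtr (Y_geo k))).
rewrite sqrtrM ?(ltW c0_ge0) // ler_wpM2l ?sqrtr_ge0 //.
elim: k => [|k IH]; first by rewrite !expr0 sqrtr1.
by rewrite !exprS sqrtrM ?(ltW r_gt0) // ler_wpM2l ?sqrtr_ge0.
Qed.

Lemma pos_lower_bound (R : realType) (I : finType) (P : pred I) (f : I -> R)
    (c : R) :
  0 < c -> (forall i, P i -> 0 < f i) ->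
  exists e, [/\ 0 < e, e <= c & forall i, P i -> e <= f i].
Proof.
move=> c_gt0 f_gt0; exists (\big[Num.min/c]_(i | P i) f i); split.
- by apply: lt_bigmin.
- exact: bigmin_le_id.
- by move=> i Pi; apply: bigmin_le_cond.
Qed.

(** * Stationarity of a block *)

(** [z] is a multiplier certifying that [u] minimizes [f y - <z, M y>] over [y]
    in [X]; the quadratic growth comes from the strong convexity of [f]. *)
Definition block_stationary (R : realType) (l n : nat) (mu : R)
    (f : 'cV[R]_n -> R) (M : 'M[R]_(l, n)) (X : set 'cV[R]_n)
    (u : 'cV[R]_n) (z : 'cV[R]_l) : Prop :=
  X u /\ forall y, X y ->
    mu / 2 * dotv (y - u) (y - u) + dotv (M *m (y - u)) z <= f y - f u.

Section BlockStationary.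
Variables (R : realType) (l n : nat) (mu : R) (f : 'cV[R]_n -> R).
Variables (M : 'M[R]_(l, n)) (X : set 'cV[R]_n).

(** Strong monotonicity of the subdifferential. *)
Lemma block_stationary_monotone u u' z z' :
  block_stationary mu f M X u z -> block_stationary mu f M X u' z' ->
  mu * dotv (u - u') (u - u') <= dotv (M *m (u - u')) (z - z').
Proof.
move=> [Xu /(_ u') Hu] [Xu' /(_ u Xu)]; have {Hu} := Hu Xu'.
rewrite (dotvv_distC u') -(opprB u u') mulmxN dotvNl (dotvBr z z'); lra.
Qed.

Lemma block_stationary_grad u z :
  0 <= mu -> X = setT -> differentiable (f : 'cV[R]_n -> R^o) u ->
  block_stationary mu f M X u z -> grad f u = M^T *m z.
Proof.
move=> mu_ge0 XT fdiff [_ Hu]; apply: grad_subgradient => // y.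
have := Hu y; rewrite XT -dotv_mulmx_tr => /(_ I).
have : 0 <= mu / 2 * dotv (y - u) (y - u).
  by rewrite mulr_ge0 ?dotvv_ge0 // divr_ge0.
by lra.
Qed.

(** The gradient of the quadratic penalty shifts the multiplier. *)
Lemma argmin_block_stationary (c z : 'cV[R]_l) (beta : R) u :
  strongly_convex mu f -> convex_set X ->
  argmin X (fun y => f y
    + (beta / 2 * dotv (M *m y + c) (M *m y + c) - dotv (M *m y) z)) u ->
  block_stationary mu f M X u (z - beta *: (M *m u + c)).
Proof.
move=> fconv Xconv umin; split=> [|y Xy]; first by case: umin.
set w := M *m (y - u).
have -> : dotv w (z - beta *: (M *m u + c)) =
    dotv w z - beta * dotv w (M *m u + c) by rewrite dotvBr dotvZr.
have := argmin_first_order (G := beta * dotv w (M *m u + c) - dotv w z)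
  (K := beta / 2 * dotv w w) fconv Xconv umin Xy.
move=> H; rewrite -lerBrDr; apply: le_trans (H _) _; last by lra.
move=> t; have -> : M *m (t *: y + (1 - t) *: u) = M *m u + t *: w.
  rewrite /w scalemxAr -mulmxDr; congr (_ *m _).
  by rewrite scalerBl scale1r scalerBr addrCA.
rewrite addrAC !(dotvDl _ (t *: _)) !(dotvDr _ (t *: _)).
rewrite !dotvZl !dotvZr (dotvC (M *m u + c) w).
by field.
Qed.

End BlockStationary.

(** * The multiplier is controlled by the primal error *)

Lemma full_row_rank_tr_bound (R : realType) (l n : nat) (M : 'M[R]_(l, n)) :
  \rank M = l ->
  exists2 c : R, 0 <= c & forall w, dotv w w <= c * dotv (M^T *m w) (M^T *m w).
Proof.
move=> /eqP rankM; have /row_freeP[B MB1] : row_free M by [].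
have [c c_ge0 Bc] := dotv_mulmx_bounded B^T; exists c => // w.
by have := Bc (M^T *m w); rewrite mulmxA -trmx_mul MB1 trmx1 mul1mx.
Qed.

Lemma nonsingular_bound (R : realType) (l n : nat) (M : 'M[R]_(l, n)) :
  nonsingular M -> \rank M = l /\
  exists2 c : R, 0 <= c & forall u, dotv u u <= c * dotv (M *m u) (M *m u).
Proof.
move=> [e]; case: l / e M => M; rewrite castmx_id => M_unit; split.
  exact: mxrank_unit.
have [c c_ge0 Mc] := dotv_mulmx_bounded (invmx M); exists c => // u.
by have := Mc (M *m u); rewrite mulKmx.
Qed.

(** Stationarity of an unconstrained smooth block reads
    [grad f u = M^T z], and [M^T] is injective. *)
Lemma multiplier_error_bound (R : realType) (l n : nat) (mu L : R)
    (f : 'cV[R]_n -> R) (M : 'M[R]_(l, n)) (X : set 'cV[R]_n) :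
  0 <= mu -> lipschitz_gradient L f -> \rank M = l -> X = setT ->
  exists2 c : R, 0 <= c & forall u u' z z',
    block_stationary mu f M X u z -> block_stationary mu f M X u' z' ->
    dotv (z - z') (z - z') <= c * dotv (u - u') (u - u').
Proof.
move=> mu_ge0 [fdiff fLip] /full_row_rank_tr_bound[c c_ge0 Mc] XT.
exists (c * L ^+ 2) => [|u u' z z' Hu Hu']; first by rewrite mulr_ge0 ?sqr_ge0.
apply: (le_trans (Mc _)); rewrite -mulrA ler_wpM2l //.
rewrite mulmxBr -(block_stationary_grad mu_ge0 XT (fdiff u) Hu).
rewrite -(block_stationary_grad mu_ge0 XT (fdiff u') Hu') -!enorm_sqr -exprMn.
by rewrite lerXn2r ?nnegrE ?enorm_ge0 ?(le_trans (enorm_ge0 _) (fLip u u')).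
Qed.

(** * Stationarity along the iterations *)

Section Stationarity.
Variables (R : realType) (m l : nat) (n : 'I_m -> nat).
Variables (theta : forall i : 'I_m, 'cV[R]_(n i) -> R).
Arguments theta : clear implicits.
Variables (A : forall i : 'I_m, 'M[R]_(l, n i)) (b : 'cV[R]_l).
Variables (X : forall i : 'I_m, set 'cV[R]_(n i)).
Arguments X : clear implicits.

Let replace (x0 : blocks R n) i (y : 'cV[R]_(n i)) : blocks R n :=
  @dfwith _ (fun j => 'cV[R]_(n j)) x0 i y.

Lemma residual_dfwith (x0 : blocks R n) i (y : 'cV[R]_(n i)) :
  residual A b (replace x0 y) =
  A i *m y + (\sum_(j < m | j != i) A j *m x0 j - b).
Proof.
rewrite /residual (bigD1 i) //= /replace dfwithin -addrA.
congr (_ + (_ - _)); apply: eq_bigr => j ji.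
by rewrite dfwithout // eq_sym.
Qed.

Lemma objective_dfwith (x0 : blocks R n) i (y : 'cV[R]_(n i)) :
  objective theta (replace x0 y) =
  theta i y + \sum_(j < m | j != i) theta j (x0 j).
Proof.
rewrite /objective (bigD1 i) //= /replace dfwithin.
congr (_ + _); apply: eq_bigr => j ji.
by rewrite dfwithout // eq_sym.
Qed.

(** Moving the multiplier against the residual would otherwise increase the
    Lagrangian. *)
Lemma saddle_residual (x0 : blocks R n) z0 :
  saddle_points theta A b X (x0, z0) -> residual A b x0 = 0.
Proof.
move=> [X0 /(_ x0 (z0 - residual A b x0) X0)/andP[+ _]] /=.
rewrite /lagrangian dotvBl => le_r; apply: dotvv_eq0; apply/le_anti.
by rewrite dotvv_ge0 andbT; lra.
Qed.

Variables (i : 'I_m) (nu : R).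
Hypothesis theta_conv : strongly_convex nu (theta i).
Hypothesis X_conv : convex_set (X i).

Lemma saddle_block_stationary (x0 : blocks R n) z0 :
  saddle_points theta A b X (x0, z0) ->
  block_stationary nu (theta i) (A i) (X i) (x0 i) z0.
Proof.
(* A subproblem without penalty. *)
move=> [X0 saddle]; rewrite -[z0]subr0 -(scale0r (A i *m x0 i + 0)).
apply: argmin_block_stationary => //; split=> [|y Xy]; first exact: X0.
have Xreplace : block_set X (replace x0 y).
  move=> j; rewrite /replace; case: (dfwithP x0 y j) => // j' _; exact: X0.
have /andP[_] := saddle _ z0 Xreplace.
rewrite /lagrangian /= objective_dfwith residual_dfwith.
rewrite /objective /residual (bigD1 i) // [X in X - b](bigD1 i) //=.
rewrite -(addrA (A i *m _)) !(dotvDr (A i *m _)) !(dotvC z0 (A i *m _)).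
by rewrite !mul0r !sub0r; lra.
Qed.

(** The subproblem of block [i] sees the residual before the blocks [j > i] are
    updated; compared with the residual that defines [z k.+1], this adds their
    increments to the multiplier. *)
Lemma eADMM_block_stationary (beta : R) (x : nat -> blocks R n)
    (z : nat -> 'cV[R]_l) k :
  eADMM theta A b X beta x z ->
  block_stationary nu (theta i) (A i) (X i) (x k.+1 i)
    (z k.+1 + beta *: \sum_(j < m | (i < j)%N)
       (A j *m x k.+1 j - A j *m x k j)).
Proof.
move=> /(_ k)[/(_ i) x_min ->].
pose x' (j : 'I_m) := if (j < i)%N then x k.+1 j else x k j.
pose c := \sum_(j < m | j != i) A j *m x' j - b.
have -> : z k - beta *: residual A b (x k.+1) + beta *:
    \sum_(j < m | (i < j)%N) (A j *m x k.+1 j - A j *m x k j) =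
    z k - beta *: (A i *m x k.+1 i + c).
  rewrite -addrA -scalerN -scalerDr -scalerN; congr (_ + _ *: _).
  have x'E : \sum_(j < m | j != i) A j *m x' j =
      \sum_(j < m | j != i) A j *m x k.+1 j
      - \sum_(j < m | (i < j)%N) (A j *m x k.+1 j - A j *m x k j).
    rewrite [X in _ - X](eq_bigl (fun j : 'I_m => (j != i) && (i < j)%N)).
      rewrite [X in _ - X]big_mkcondr -sumrB; apply: eq_bigr => j.
      rewrite -(inj_eq val_inj) /x' /=; case: ltngtP => // _ _.
        by rewrite subr0.
      by rewrite subKr.
    by move=> j; rewrite -(inj_eq val_inj) /=; case: ltngtP.
  rewrite /c x'E /residual (bigD1 i) //=; apply: oppr_inj.
  by rewrite opprD !opprK -!addrA; congr (_ + (_ + _)); rewrite addrC.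
apply: argmin_block_stationary => //; case: x_min => Xi x_min; split=> // y Xy.
have := x_min y Xy; rewrite /aug_lagrangian /lagrangian !enorm_sqr.
rewrite !residual_dfwith !objective_dfwith -/x' -/c.
rewrite !(dotvDr (A i *m _) c (z k)) !(dotvC (z k)); lra.
Qed.

End Stationarity.

(** * The step size *)

(** If [A_i^T A_i] has norm zero, the bound on [beta] is infinite and the
    left-hand side vanishes. *)
Lemma step_size_gap (R : realType) (m l : nat) (n : 'I_m -> nat)
    (A : forall i : 'I_m, 'M[R]_(l, n i)) (mu : 'I_m -> R) (beta : R)
    (i : 'I_m) :
  (3 <= m)%N -> (1 < i)%N -> 0 < beta -> 0 < mu i ->
  (beta%:E < beta_bound A mu)%E ->
  (3 * m%:R - 13 / 2) * spectral_norm ((A i)^T *m A i) < mu i / beta.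
Proof.
move=> m_ge3 i_gt1 beta_gt0 mu_gt0 beta_lt.
have m_ge3R : 3 <= m%:R :> R by rewrite ler_nat.
set c := 3 * m%:R - 13 / 2; set s := spectral_norm _.
pose K := Num.max (4 * m%:R - 10) c * s.
have c_gt0 : 0 < c by rewrite /c; lra.
have max_ge : c <= Num.max (4 * m%:R - 10) c by rewrite le_max lexx orbT.
have max_gt0 := lt_le_trans c_gt0 max_ge.
have {beta_lt} : (beta%:E < (mu i)%:E / K%:E)%E.
  by apply: (lt_le_trans beta_lt); apply: bigmin_le_cond.
rewrite inver; case: eqP => [/eqP|/eqP K_neq0].
  rewrite mulf_eq0 gt_eqF //= => /eqP -> _.
  by rewrite mulr0 divr_gt0.
rewrite -EFinM lte_fin => beta_lt.
have K_gt0 : 0 < K.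
  rewrite lt_def K_neq0 leNgt; apply/negP => K_lt0.
  have : mu i / K < 0 by rewrite pmulr_rlt0 ?invr_lt0.
  by lra.
have s_gt0 : 0 < s by move: K_gt0; rewrite pmulr_rgt0.
rewrite ltr_pdivlMr //; apply: (@le_lt_trans _ _ (beta * K)).
  by rewrite mulrC ler_pM2l // ler_pM2r.
by rewrite -ltr_pdivlMr.
Qed.

(** * Convergence *)

Section Convergence.
Variables (R : realType) (m l : nat) (n : 'I_m -> nat).
Variable theta : forall i : 'I_m, 'cV[R]_(n i) -> R.
Variables (A : forall i : 'I_m, 'M[R]_(l, n i)) (b : 'cV[R]_l).
Variable X : forall i : 'I_m, set 'cV[R]_(n i).
Arguments theta : clear implicits.
Arguments X : clear implicits.
Variables (mu L : 'I_m -> R) (beta : R).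
Variables (x : nat -> blocks R n) (z : nat -> 'cV[R]_l).
Variables (xs : blocks R n) (zs : 'cV[R]_l).
Hypothesis m_ge3 : (3 <= m)%N.
Hypothesis mu_gt0 : forall i : 'I_m, (0 < i)%N -> 0 < mu i.
Hypothesis beta_gt0 : 0 < beta.
Hypothesis beta_lt : (beta%:E < beta_bound A mu)%E.
Hypothesis conditions :
  (exists i : 'I_m, [/\ (0 < i)%N, lipschitz_gradient (L i) (theta i),
     \rank (A i) = l & X i = setT]) \/
  (exists i : 'I_m, [/\ i = 0%N :> nat, lipschitz_gradient (L i) (theta i),
     nonsingular (A i) & X i = setT]).

(** Plain convexity is strong convexity with modulus 0, which serves block 0. *)
Let nu (i : 'I_m) : R := if (0 < i)%N then mu i else 0.

Let err k (i : 'I_m) : 'cV[R]_(n i) := x k i - xs i.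
Let a k (i : 'I_m) : 'cV[R]_l := A i *m err k i.
Let p k : 'cV[R]_l := beta^-1 *: (z k - zs).
Let d k (i : 'I_m) : 'cV[R]_l := a k.+1 i - a k i.
Let zeta k (i : 'I_m) : 'cV[R]_l :=
  z k.+1 + beta *: \sum_(j < m | (i < j)%N) d k j.

Hypothesis xs_stationary : forall i,
  block_stationary (nu i) (theta i) (A i) (X i) (xs i) zs.
Hypothesis x_stationary : forall k i,
  block_stationary (nu i) (theta i) (A i) (X i) (x k.+1 i) (zeta k i).
Hypothesis p_step : forall k, p k - p k.+1 = \sum_i a k.+1 i.

Let nu_ge0 i : 0 <= nu i.
Proof. by rewrite /nu; case: ifP => // /mu_gt0/ltW. Qed.

Let z_p k : z k - zs = beta *: p k.
Proof. by rewrite /p scalerA mulfV ?gt_eqF // scale1r. Qed.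

Lemma error_monotone k i :
  nu i / beta * dotv (err k.+1 i) (err k.+1 i) <=
  dotv (a k.+1 i) (p k.+1 + \sum_(j < m | (i < j)%N) d k j).
Proof.
have := block_stationary_monotone (x_stationary k i) (xs_stationary i).
rewrite -/(err k.+1 i) -/(a k.+1 i) /zeta addrAC z_p -scalerDr dotvZr.
by rewrite mulrAC ler_pdivrMr // (mulrC beta).
Qed.

(** For two successive iterates the difference of the multipliers consists of
    increments only, and [zs] drops out. *)
Lemma increment_monotone k i :
  nu i / beta * dotv (err k.+2 i - err k.+1 i) (err k.+2 i - err k.+1 i) <=
  dotv (d k.+1 i)
    (\sum_(j < m | (i < j)%N) (d k.+1 j - d k j) - (p k.+1 - p k.+2)).
Proof.
have := block_stationary_monotone (x_stationary k.+1 i) (x_stationary k i).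
have -> : x k.+2 i - x k.+1 i = err k.+2 i - err k.+1 i.
  by rewrite /err opprB addrA subrK.
have -> : zeta k.+1 i - zeta k i = beta *:
    (\sum_(j < m | (i < j)%N) (d k.+1 j - d k j) - (p k.+1 - p k.+2)).
  have zE : z k.+2 - z k.+1 = beta *: (p k.+2 - p k.+1).
    by rewrite scalerBr -!z_p opprB addrA subrK.
  rewrite /zeta opprD addrACA -scalerBr zE -scalerDr.
  by rewrite (sumrB _ _ (d k.+1) (d k)) opprB addrC.
rewrite mulmxBr -/(a k.+2 i) -/(a k.+1 i) -/(d k.+1 i) dotvZr.
by rewrite mulrAC ler_pdivrMr // (mulrC beta).
Qed.

(** [B] bounds all the errors of an iterate: those of the blocks other than
    block 0 directly, the multiplier through the smooth block, and block 0
    through the primal residual, which is [p k - p k.+1]. *)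
Let B k : R := dotv (p k - p k.+1) (p k - p k.+1)
  + \sum_(i < m | (0 < i)%N)
      (dotv (err k.+1 i) (err k.+1 i) + dotv (d k i) (d k i)).

Let B_ge0 k : 0 <= B k.
Proof.
rewrite addr_ge0 ?dotvv_ge0 // sumr_ge0 // => i _.
by rewrite addr_ge0 ?dotvv_ge0.
Qed.

Let dotv_err_le k (i : 'I_m) : (0 < i)%N ->
  dotv (err k.+1 i) (err k.+1 i) + dotv (d k i) (d k i) <= B k.
Proof.
move=> i_gt0; rewrite /B (bigD1 i) //= addrCA lerDl addr_ge0 ?dotvv_ge0 //.
by rewrite sumr_ge0 // => j _; rewrite addr_ge0 ?dotvv_ge0.
Qed.

(** The constants of the estimates below are not tracked. *)
Let bounded (f : nat -> R) := exists2 C : R, 0 <= C & forall k, f k <= C * B k.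

Let boundedD f g : bounded f -> bounded g -> bounded (fun k => f k + g k).
Proof.
move=> [C C_ge0 fC] [C' C'_ge0 gC]; exists (C + C') => [|k].
  exact: addr_ge0.
by rewrite mulrDl lerD.
Qed.

Let boundedZ c f : 0 <= c -> bounded f -> bounded (fun k => c * f k).
Proof.
move=> c_ge0 [C C_ge0 fC]; exists (c * C) => [|k]; first exact: mulr_ge0.
by rewrite -mulrA ler_wpM2l.
Qed.

Let bounded_le f g : (forall k, f k <= g k) -> bounded g -> bounded f.
Proof. by move=> fg [C ? gC]; exists C => // k; apply: le_trans (gC k). Qed.

Let bounded_sum (P : pred 'I_m) (f : 'I_m -> nat -> R) :
  (forall i, P i -> bounded (f i)) -> bounded (fun k => \sum_(i | P i) f i k).
Proof.
move=> Pf; suff: forall r : seq 'I_m,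
  bounded (fun k => \sum_(i <- r | P i) f i k) by apply.
elim=> [|i r IH].
  by exists 0 => // k; rewrite big_nil mul0r.
case Pi: (P i).
  by apply: bounded_le (boundedD (Pf i Pi) IH) => k; rewrite big_cons Pi.
by apply: bounded_le IH => k; rewrite big_cons Pi.
Qed.

Lemma bounded_err (i : 'I_m) : (0 < i)%N ->
  bounded (fun k => dotv (err k.+1 i) (err k.+1 i)).
Proof.
move=> i_gt0; exists 1 => // k; rewrite mul1r.
by apply: le_trans (dotv_err_le k i_gt0); rewrite lerDl dotvv_ge0.
Qed.

Lemma bounded_d (i : 'I_m) : (0 < i)%N ->
  bounded (fun k => dotv (d k i) (d k i)).
Proof.
move=> i_gt0; exists 1 => // k; rewrite mul1r.
by apply: le_trans (dotv_err_le k i_gt0); rewrite lerDr dotvv_ge0.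
Qed.

Lemma bounded_a (i : 'I_m) : bounded (fun k => dotv (a k.+1 i) (a k.+1 i)).
Proof.
have pos (j : 'I_m) : (0 < j)%N ->
    bounded (fun k => dotv (a k.+1 j) (a k.+1 j)).
  move=> j_gt0; have [c c_ge0 Ac] := dotv_mulmx_bounded (A j).
  by apply: bounded_le (boundedZ c_ge0 (bounded_err j_gt0)) => k; apply: Ac.
have [|i_le0] := ltnP 0 i; first exact: pos.
(* Block 0 is recovered from the primal residual. *)
pose r k := \sum_(j < m | (0 < j)%N) a k.+1 j.
have aE k : a k.+1 i = p k - p k.+1 - r k.
  rewrite p_step (bigD1 i) //= -/(r k) (eq_bigl (fun j : 'I_m => (0 < j)%N)).
    by rewrite addrK.
  move=> j; rewrite -(inj_eq val_inj) /= lt0n.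
  by move: i_le0; rewrite leqn0 => /eqP ->.
apply: (@bounded_le _ (fun k => 2 * dotv (p k - p k.+1) (p k - p k.+1)
    + 2 * (#|[pred j : 'I_m | (0 < j)%N]|%:R
           * \sum_(j < m | (0 < j)%N) dotv (a k.+1 j) (a k.+1 j)))).
  move=> k; rewrite aE; apply: (le_trans (dotvvB_le _ _)).
  by rewrite lerD2l ler_pM2l //; apply: dotvv_sum_le.
apply: boundedD; apply: boundedZ => //.
  exists 1 => // k; rewrite mul1r lerDl sumr_ge0 // => j _.
  by rewrite addr_ge0 ?dotvv_ge0.
by apply: boundedZ => //; apply: bounded_sum.
Qed.

(** The multiplier of the smooth block differs from [z k.+1] by increments of
    later blocks, which are in [B]. *)
Lemma bounded_p : bounded (fun k => dotv (p k.+1) (p k.+1)).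
Proof.
have [i [lip rankA XT err_i]] : exists i,
    [/\ lipschitz_gradient (L i) (theta i), \rank (A i) = l, X i = setT &
        bounded (fun k => dotv (err k.+1 i) (err k.+1 i))].
  case: conditions => -[i [i_pos lip hA XT]]; exists i.
    by split=> //; apply: bounded_err.
  have [rankA [c c_ge0 Ac]] := nonsingular_bound hA; split=> //.
  by apply: bounded_le (boundedZ c_ge0 (bounded_a i)) => k; apply: Ac.
have [c c_ge0 zc] := multiplier_error_bound (nu_ge0 i) lip rankA XT.
pose r k := \sum_(j < m | (i < j)%N) d k j.
have pE k : p k.+1 = beta^-1 *: (zeta k i - zs) - r k.
  rewrite /zeta addrAC z_p -scalerDr scalerA mulVf ?gt_eqF // scale1r.
  by rewrite addrK.
apply: (@bounded_le _ (fun k => 2 * (beta^-1 ^+ 2 *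
    (c * dotv (err k.+1 i) (err k.+1 i)))
    + 2 * (#|[pred j : 'I_m | (i < j)%N]|%:R
           * \sum_(j < m | (i < j)%N) dotv (d k j) (d k j)))).
  move=> k; rewrite pE; apply: (le_trans (dotvvB_le _ _)).
  rewrite lerD // ler_pM2l //; last exact: dotvv_sum_le.
  rewrite dotvZl dotvZr mulrA -expr2 ler_wpM2l ?sqr_ge0 //; exact: zc.
apply: boundedD; apply: boundedZ => //; apply: boundedZ; rewrite ?sqr_ge0 //.
  exact: boundedZ.
by apply: bounded_sum => j ij; apply: bounded_d; apply: leq_ltn_trans ij.
Qed.

Lemma bounded_merit : bounded (fun k => merit (p k.+1) (a k.+1) (d k)).
Proof.
have m_ge3R : 3 <= m%:R :> R by rewrite ler_nat.
apply: boundedD; first apply: boundedD.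
- by apply: boundedZ bounded_p; rewrite invr_ge0.
- apply: boundedZ; first by rewrite invr_ge0.
  by apply: bounded_sum => i _; apply: bounded_a.
apply: boundedZ; first by lra.
apply: bounded_sum => i i_gt1; apply: boundedD; first exact: bounded_a.
by apply: bounded_d; apply: ltnW.
Qed.

(** Strong convexity yields the hypotheses of [merit_decrease] with one [eps]
    for all blocks and all steps. *)
Lemma merit_decrease_uniform :
  exists2 eps : R, 0 < eps & forall k,
    merit (p k.+2) (a k.+2) (d k.+1) + eps * B k.+1
    <= merit (p k.+1) (a k.+1) (d k).
Proof.
(* The margin left by the strong convexity of each block: all of it for block 1,
   and what the step size spares for the others. *)
pose s i := spectral_norm ((A i)^T *m A i).
pose c : R := 3 * m%:R - 13 / 2.
pose f (i : 'I_m) := if (1 < i)%N then mu i / beta - c * s i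
            else mu i / beta / (1 + `|s i|).
have s1_gt0 i : 0 < 1 + `|s i| by rewrite ltr_pwDl.
have f_gt0 (i : 'I_m) : (0 < i)%N -> 0 < f i.
  move=> i_gt0; rewrite /f; case: ifP => [i_gt1|_].
    by rewrite subr_gt0; apply: step_size_gap => //; apply: mu_gt0.
  by rewrite !divr_gt0 // mu_gt0.
have half_gt0 : 0 < 2^-1 :> R by rewrite invr_gt0.
have [eps [eps_gt0 eps_le eps_f]] := pos_lower_bound half_gt0 f_gt0.
exists eps => // k.
have m_ge3R : 3 <= m%:R :> R by rewrite ler_nat.
have As i u : dotv (A i *m u) (A i *m u) <= s i * dotv u u.
  exact: dotv_mulmx_le_gram.
have gap1 (i : 'I_m) u : i = 1%N :> nat ->
    eps * dotv u u <= nu i / beta * dotv u u /\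
    eps * dotv (A i *m u) (A i *m u) <= nu i / beta * dotv u u.
  move=> i1; have i_gt0 : (0 < i)%N by rewrite i1.
  have := eps_f i i_gt0; rewrite /f {1}i1 ltnn /nu i_gt0 ler_pdivlMr //.
  have := ler_norm (s i); have := normr_ge0 (s i) => s_ge0 s_le eps_s.
  have := As i u; have := dotvv_ge0 u => u_ge0 Au; split.
    by apply: ler_wpM2r => //; nra.
  apply: (@le_trans _ _ (eps * (s i * dotv u u))); first by rewrite ler_pM2l.
  by rewrite mulrA; apply: ler_wpM2r => //; nra.
have gap (i : 'I_m) u : (1 < i)%N ->
    c * dotv (A i *m u) (A i *m u) + eps * dotv u u <= nu i / beta * dotv u u.
  move=> i_gt1; have i_gt0 := ltnW i_gt1.
  have := eps_f i i_gt0; rewrite /f i_gt1 /nu i_gt0 => eps_s.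
  have cAu : c * dotv (A i *m u) (A i *m u) <= c * (s i * dotv u u).
    by rewrite ler_wpM2l // /c; lra.
  apply: (@le_trans _ _ ((c * s i + eps) * dotv u u)).
    by rewrite (mulrDl (c * s i)) -mulrA lerD2r.
  by apply: ler_wpM2r; [exact: dotvv_ge0 | lra].
have dE i : A i *m (err k.+2 i - err k.+1 i) = d k.+1 i by rewrite mulmxBr.
have := merit_decrease (u' := a k)
  (E := fun i => dotv (err k.+2 i) (err k.+2 i))
  m_ge3 eps_le (p_step k.+1) (error_monotone k.+1)
  (fun i _ => increment_monotone k i).
have M_ge0 (i : 'I_m) : 0 <= nu i / beta * dotv (err k.+2 i) (err k.+2 i).
  by rewrite mulr_ge0 ?dotvv_ge0 // divr_ge0 // ltW.
move=> /(_ M_ge0) dec.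
apply: le_trans (dec _ _); last 2 first.
- move=> i i1; have [+ _] := gap1 i (err k.+2 i) i1.
  by have [_ +] := gap1 i (err k.+2 i - err k.+1 i) i1; rewrite dE.
- move=> i i_gt1; have := gap i (err k.+2 i - err k.+1 i) i_gt1.
  rewrite dE; split; first exact: gap.
  apply: le_trans (_ : _ <= _); last by eassumption.
  by rewrite lerDl mulr_ge0 ?dotvv_ge0 // ltW.
by rewrite lerD2l /B mulrDr lerD2r ler_wpM2r // dotvv_ge0.
Qed.

Lemma image_point_dist k :
  enorm (image_point A (x k) (z k) - image_point A xs zs) =
  Num.sqrt (\sum_i dotv (a k i) (a k i) + beta ^+ 2 * dotv (p k) (p k)).
Proof.
rewrite /enorm /image_point opp_col_mx add_col_mx -mxcolN -mxcolD.
rewrite dotv_col_mx dotv_mxcol z_p dotvZl dotvZr mulrA -expr2.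
congr (Num.sqrt (_ + _)); apply: eq_bigr => i _.
by rewrite /a /err mulmxBr.
Qed.

Lemma R_linear_cvg_image_point :
  R_linear_cvg (fun k => image_point A (x k.+1) (z k.+1))
    (image_point A xs zs).
Proof.
have [eps eps_gt0 dec] := merit_decrease_uniform.
pose Y k := \sum_i dotv (a k.+1 i) (a k.+1 i)
            + beta ^+ 2 * dotv (p k.+1) (p k.+1).
have [C1 C1_ge0 meritC] := bounded_merit.
have [C2 C2_ge0 YC] : bounded Y.
  apply: boundedD; first by apply: bounded_sum => i _; apply: bounded_a.
  by apply: boundedZ bounded_p; rewrite sqr_ge0.
have C_ge0 : 0 <= (C1 + C2) / eps by rewrite divr_ge0 ?addr_ge0 // ltW.
have le_C C k : C <= C1 + C2 -> C * B k <= (C1 + C2) / eps * (eps * B k).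
  by move=> C_le; rewrite mulrA divfK ?gt_eqF // ler_wpM2r.
have merit_ge0 k : 0 <= merit (p k.+1) (a k.+1) (d k).
  have m_ge3R : 3 <= m%:R :> R by rewrite ler_nat.
  apply: addr_ge0; first apply: addr_ge0.
  - by rewrite mulr_ge0 ?invr_ge0 ?dotvv_ge0.
  - by rewrite mulr_ge0 ?invr_ge0 // sumr_ge0 // => i _; apply: dotvv_ge0.
  apply: mulr_ge0; first by lra.
  by apply: sumr_ge0 => i _; apply: addr_ge0; apply: dotvv_ge0.
have Y_ge0 k : 0 <= Y k.
  apply: addr_ge0; last by rewrite mulr_ge0 ?sqr_ge0 ?dotvv_ge0.
  by apply: sumr_ge0 => i _; apply: dotvv_ge0.
have D_ge0 k : 0 <= eps * B k.+1 by rewrite mulr_ge0 // ltW.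
have merit_le k : merit (p k.+2) (a k.+2) (d k.+1) <=
    (C1 + C2) / eps * (eps * B k.+1).
  by apply: (le_trans (meritC _)); apply: le_C; rewrite ?lerDl.
have Y_le k : Y k.+1 <= (C1 + C2) / eps * (eps * B k.+1).
  by apply: (le_trans (YC _)); apply: le_C; rewrite ?lerDr.
have [c [q [c_gt0 q01 Yq]]] :=
  sqrt_geometric_bound C_ge0 merit_ge0 D_ge0 Y_ge0 dec merit_le Y_le.
by exists c, q; split=> // k; rewrite image_point_dist; apply: Yq.
Qed.

End Convergence.
Unset Implicit Arguments.

Theorem theorem5p1 (R : realType) (m l : nat) (n : 'I_m -> nat)
  (theta : forall i : 'I_m, 'cV[R]_(n i) -> R)
  (A : forall i : 'I_m, 'M[R]_(l, n i)) (b : 'cV[R]_l)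
  (X : forall i : 'I_m, set 'cV[R]_(n i))
  (mu L : 'I_m -> R) (beta : R)
  (x : nat -> blocks R n) (z : nat -> 'cV[R]_l)
  (m_ge3 : (3 <= m)%N)
  (theta_closed : forall i, closed_function (theta i))
  (theta_convex : forall i, convex_function setT (theta i))
  (X_nonempty : forall i, X i !=set0)
  (X_closed : forall i, closed (X i))
  (X_convex : forall i, convex_set (X i))
  (solvable : solutions theta A b X !=set0)
  (saddle_exists : saddle_points theta A b X !=set0)
  (mu_gt0 : forall i : 'I_m, (2 <= i.+1)%N -> 0 < mu i)
  (theta_strong : forall i : 'I_m, (2 <= i.+1)%N ->
     strongly_convex (mu i) (theta i))
  (conditions :
     (exists i : 'I_m, [/\ (2 <= i.+1)%N, lipschitz_gradient (L i) (theta i),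
        \rank (A i) = l & X i = setT]) \/
     (exists i : 'I_m, [/\ i.+1 = 1%N, lipschitz_gradient (L i) (theta i),
        nonsingular (A i) & X i = setT]))
  (beta_gt0 : 0 < beta)
  (beta_lt : (beta%:E < beta_bound A mu)%E)
  (generated : eADMM theta A b X beta x z) :
  exists2 y : 'cV[R]_(\sum_(i < m) l + l),
    [set image_point A w.1 w.2 | w in saddle_points theta A b X] y &
    R_linear_cvg (fun k : nat => image_point A (x k.+1) (z k.+1)) y.
Proof.
(* All saddle points have the same image, so any of them gives the limit. *)
have [[xs zs] saddle] := saddle_exists.
exists (image_point A xs zs); first by exists (xs, zs).
pose nu (i : 'I_m) : R := if (0 < i)%N then mu i else 0.
have theta_nu i : strongly_convex (nu i) (theta i).
  rewrite /nu; case: ifP => [i_gt0|_]; first exact: theta_strong.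
  exact: strongly_convex0.
apply: (R_linear_cvg_image_point (theta := theta) (X := X) (mu := mu) (L := L)
  (beta := beta)) => //.
- case: conditions => -[i [i_pos lip hA XT]]; [left|right]; exists i => //.
  by case: i_pos => ->.
- move=> i.
  exact: (saddle_block_stationary (theta_nu i) (X_convex i) saddle).
- move=> k i.
  move: (eADMM_block_stationary (theta_nu i) (X_convex i) k generated).
  rewrite (eq_bigr
    (fun j => A j *m (x k.+1 j - xs j) - A j *m (x k j - xs j))) //.
  by move=> j _; rewrite !mulmxBr opprB addrA subrK.
- move=> k; have [_ zE] := generated k.
  rewrite -scalerBr opprB addrA subrK zE opprB addrCA subrr addr0.
  rewrite scalerA mulVf ?gt_eqF // scale1r.
  rewrite -[LHS]subr0 -[X in _ - X](saddle_residual saddle) /residual.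
  rewrite opprB addrA addrNK.
  by rewrite -sumrB; apply: eq_bigr => i _; rewrite mulmxBr.
Qed.
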